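(* The space $L_{oc}^\diamond(\ell_0^\infty,\ell_0^\infty)$ is not majorizing in $L_{oc}(\ell_0^\infty,\ell^\infty)$, and therefore it is not order dense in $L_{oc}(\ell_0^\infty,\ell^\infty)$.
   Context: $\ell^\infty$ is the vector lattice of all bounded real sequences $(x_i)_{i\in\mathbb{N}}$ with the pointwise order, and $\ell_0^\infty=\{(x_i)_{i\in\mathbb{N}} : \exists c\in\mathbb{R}\ \exists k\in\mathbb{N}\ \forall i\ge k\colon x_i=c\}$ is its vector sublattice of eventually constant sequences, with the pointwise order. ($\ell^\infty$ is the Dedekind completion of $\ell_0^\infty$.) Let $X,Z$ be ordered vector spaces with $X$ directed (any two elements have a common upper bound). For a net, $z_\alpha\downarrow 0$ means that $\alpha\le\beta$ implies $z_\alpha\ge z_\beta$ and $\inf_\alpha z_\alpha=0$. A net $(x_\alpha)_\alpha$ in $X$ order converges to $x\in X$ if there is a net $(z_\alpha)_\alpha$ in $X$ (with the same index set) such that $z_\alpha\downarrow 0$ and $\pm(x-x_\alpha)\le z_\alpha$ for every $\alpha$. A linear operator $T\colon X\to Z$ is order continuous if for every net $(x_\alpha)_\alpha$ in $X$ that order converges to some $x\in X$, the net $(T(x_\alpha))_\alpha$ order converges to $T(x)$ in $Z$. A linear operator $T$ is positive if $T(X_+)\subseteq Z_+$. $L_{oc}(X,Z)$ is the space of all order continuous linear operators from $X$ to $Z$, ordered by $S\le T$ iff $T-S$ is positive; $L_{oc}(X,Z)_+$ is the set of positive operators in $L_{oc}(X,Z)$; and $L_{oc}^\diamond(X,Z):=L_{oc}(X,Z)_+-L_{oc}(X,Z)_+$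 is its directed part. Composition with the inclusion $\ell_0^\infty\subseteq\ell^\infty$ preserves order continuity, so $L_{oc}^\diamond(\ell_0^\infty,\ell_0^\infty)$ is regarded as a linear subspace of $L_{oc}(\ell_0^\infty,\ell^\infty)$. A linear subspace $D$ of an ordered vector space $X$ is majorizing in $X$ if for every $x\in X$ there is $d\in D$ with $x\le d$. It is order dense in $X$ if for every $x\in X$ the infimum of $\{z\in D : x\le z\}$ exists in $X$ and equals $x$. *)

(* Defs.v *)
From HB Require Import structures.
From mathcomp Require Import all_boot all_order all_algebra.
From mathcomp Require Import all_classical reals normedtype.

Set Implicit Arguments.
Unset Strict Implicit.
Unset Printing Implicit Defensive.

Import Order.TTheory GRing.Theory Num.Theory.
(* makes R a module over itself, hence nat -> R an lmodType R *)
Import numFieldNormedType.Exports.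
Local Open Scope classical_set_scope.
Local Open Scope ring_scope.

HB.mixin Record Lmodule_isOrdered (R : numDomainType) V
    of GRing.Lmodule R V & Num.POrderedZmodule V := {
  lev_addr : forall u v w : V, u <= v -> u + w <= v + w;
  lev_scale : forall (a : R) (u v : V), 0 <= a -> u <= v -> a *: u <= a *: v
}.

#[short(type="ordVectType")]
HB.structure Definition OrdVect (R : numDomainType) :=
  { V of Lmodule_isOrdered R V & GRing.Lmodule R V & Num.POrderedZmodule V }.

HB.mixin Record OrdVect_isDirected (R : numDomainType) V of OrdVect R V := {
  ov_directed : forall u v : V, exists w : V, u <= w /\ v <= w
}.

#[short(type="dirOrdVectType")]
HB.structure Definition DirOrdVect (R : numDomainType) :=
  { V of OrdVect R V & OrdVect_isDirected R V }.

Section OrdVectTheory.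
Context {R : numDomainType} {V : ordVectType R}.
Implicit Types u v w : V.

Lemma lev_subr u v : (u <= v) = (0 <= v - u).
Proof.
apply/idP/idP => uv.
  by rewrite -(subrr u); exact: lev_addr.
by rewrite -[u]add0r -[v](subrK u); exact: lev_addr.
Qed.

Lemma lev_subl u v w : (u - v <= w) = (u <= w + v).
Proof. by rewrite [LHS]lev_subr [RHS]lev_subr opprB addrA addrAC. Qed.

Lemma lev_add2 u v u' v' : u <= u' -> v <= v' -> u + v <= u' + v'.
Proof.
move=> uu' vv'; apply: (@le_trans _ _ (u' + v)); first exact: lev_addr.
by rewrite ![u' + _]addrC; exact: lev_addr.
Qed.

Lemma addv_ge0 u v : 0 <= u -> 0 <= v -> 0 <= u + v.
Proof. by move=> u0 v0; have := lev_add2 u0 v0; rewrite addr0. Qed.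

Lemma scalev_ge0 (a : R) u : 0 <= a -> 0 <= u -> 0 <= a *: u.
Proof. by move=> a0 u0; rewrite -(scaler0 _ a); exact: lev_scale. Qed.

Definition majorizing (D : set V) : Prop :=
  forall x : V, exists2 d, D d & x <= d.

(* The infimum is taken in V, not in D. *)
Definition order_dense (D : set V) : Prop :=
  forall x : V, infimums [set z | D z /\ x <= z] x.

Definition directed_part : set V :=
  [set v | exists a b : V, [/\ 0 <= a, 0 <= b & v = a - b]].

End OrdVectTheory.

Lemma directed_part_submod (R : realDomainType) (V : ordVectType R) :
  directed_part (0 : V) /\
  forall (a : R) (u v : V),
    directed_part u -> directed_part v -> directed_part (a *: u + v).
Proof.
split=> [|a _ _ [p [q [p0 q0 ->]]] [r [s [r0 s0 ->]]]].
  by exists 0, 0; rewrite subrr.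
have [a0|/ltW a0] := leP 0 a.
  exists (a *: p + r), (a *: q + s); split; try exact: addv_ge0 (scalev_ge0 _ _) _.
  by rewrite scalerBr opprD addrACA.
have na0 : 0 <= - a by rewrite oppr_ge0.
exists (- a *: q + r), (- a *: p + s).
split; try exact: addv_ge0 (scalev_ge0 _ _) _.
by rewrite opprD addrACA !scaleNr opprK scalerBr [- _ + _]addrC.
Qed.

(* Nets are indexed by directed preorders; antisymmetry is not required. *)
Definition directed_index d (I : preorderType d) : Prop :=
  inhabited I /\ forall i j : I, exists k : I, (i <= k)%O /\ (j <= k)%O.

Section OrderConvergence.
Context {R : numDomainType}.

Definition decr_to0 (X : ordVectType R) d (I : preorderType d) (z : I -> X) :
    Prop :=
  (forall i j : I, (i <= j)%O -> z j <= z i) /\ infimums (range z) 0.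

Definition order_cvg (X : ordVectType R) d (I : preorderType d)
    (x_ : I -> X) (x : X) : Prop :=
  exists z : I -> X, decr_to0 z /\
    forall i, x - x_ i <= z i /\ - (x - x_ i) <= z i.

Definition order_continuous (X : dirOrdVectType R) (Z : ordVectType R)
    (T : X -> Z) : Prop :=
  forall d (I : preorderType d) (x_ : I -> X) (x : X),
    directed_index I -> order_cvg x_ x -> order_cvg (T \o x_) (T x).

Definition positive_op (X Z : ordVectType R) (T : X -> Z) : Prop :=
  forall x, 0 <= x -> 0 <= T x.

End OrderConvergence.

Section DecrTo0.
Context {R : realFieldType} {Z : ordVectType R} {d} {I : preorderType d}.
Hypothesis dirI : directed_index I.
Implicit Types z w : I -> Z.

Lemma decr_to0_cst0 : decr_to0 ((fun=> 0) : I -> Z).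
Proof.
have [[i0] _] := dirI; split=> //; split => [_ [i _ <-]//|u]; apply.
by exists i0.
Qed.

Lemma decr_to0_add z w :
  decr_to0 z -> decr_to0 w -> decr_to0 (fun i => z i + w i).
Proof.
move=> [zd [z0 zinf]] [wd [w0 winf]]; split.
  by move=> i j ij; apply: lev_add2; [exact: zd | exact: wd].
split.
  by move=> _ [i _ <-]; apply: addv_ge0; [apply: z0 | apply: w0]; exists i.
move=> u ulb; apply: winf => _ [j _ <-].
suff : u - w j <= 0 by rewrite lev_subl add0r.
apply: zinf => _ [i _ <-]; rewrite lev_subl.
have [_ /(_ i j)[k [ik jk]]] := dirI.
apply: (@le_trans _ _ (z k + w k)); first by apply: ulb; exists k.
by apply: lev_add2; [exact: zd | exact: wd].
Qed.

Lemma decr_to0_scale (a : R) z :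
  0 < a -> decr_to0 z -> decr_to0 (fun i => a *: z i).
Proof.
move=> a0 [zd [z0 zinf]]; split.
  by move=> i j ij; apply: lev_scale; [exact: ltW | exact: zd].
split.
  by move=> _ [i _ <-]; apply: scalev_ge0; [exact: ltW | apply: z0; exists i].
move=> u ulb; rewrite -[u](scalerKV (lt0r_neq0 a0)) -(scaler0 _ a).
apply: lev_scale; first exact: ltW.
apply: zinf => _ [i _ <-]; rewrite -[z i](scalerK (lt0r_neq0 a0)).
by apply: lev_scale; [rewrite invr_ge0 ltW | apply: ulb; exists i].
Qed.

Lemma order_cvg_add (x_ y_ : I -> Z) (x y : Z) :
  order_cvg x_ x -> order_cvg y_ y ->
  order_cvg (fun i => x_ i + y_ i) (x + y).
Proof.
move=> [z [zd zP]] [w [wd wP]]; exists (fun i => z i + w i).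
split=> [|i]; first exact: decr_to0_add.
have [z1 z2] := zP i; have [w1 w2] := wP i.
by rewrite opprD addrACA opprD; split; exact: lev_add2.
Qed.

Lemma order_cvg_scale (a : R) (x_ : I -> Z) (x : Z) :
  order_cvg x_ x -> order_cvg (fun i => a *: x_ i) (a *: x).
Proof.
move=> [z [zd zP]]; have [a0|a0|->] := ltgtP a 0.
- exists (fun i => - a *: z i).
  split=> [|i]; first by apply: decr_to0_scale => //; rewrite oppr_gt0.
  have na0 : 0 <= - a by rewrite oppr_ge0 ltW.
  have [z1 z2] := zP i; rewrite -scalerBr; split.
    by rewrite -[leLHS]opprK -scaleNr -scalerN; exact: lev_scale.
  by rewrite -scaleNr; exact: lev_scale.
- exists (fun i => a *: z i); split=> [|i]; first exact: decr_to0_scale.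
  have [z1 z2] := zP i; rewrite -scalerBr -scalerN.
  by split; apply: lev_scale => //; exact: ltW.
- exists (fun=> 0); split=> [|i]; first exact: decr_to0_cst0.
  by rewrite !scale0r subrr oppr0.
Qed.

End DecrTo0.

Section Loc.
Context {R : realFieldType} (X : dirOrdVectType R) (Z : ordVectType R).

Definition Loc_pred : {pred X -> Z} :=
  fun T => `[< linear T /\ order_continuous T >].

Lemma Loc_submod_closed : submod_closed Loc_pred.
Proof.
split=> [|a S T /asboolP[linS ocS] /asboolP[linT ocT]]; apply/asboolP.
  split=> [b x y|d I x_ x dirI _]; first by rewrite scaler0 addr0.
  exists (fun=> 0); split=> [|i]; first exact: decr_to0_cst0.
  by rewrite /= subrr oppr0.
split=> [b x y|d I x_ x dirI x_x].
  have aux (p q r s : Z) :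
      a *: (b *: p + q) + (b *: r + s) = b *: (a *: p + r) + (a *: q + s).
    by rewrite !scalerDr !scalerA [a * b]mulrC addrACA.
  have E z : (a *: S + T) z = a *: S z + T z by [].
  by rewrite !E linS linT; exact: aux.
apply: order_cvg_add => //; last exact: ocT.
by apply: order_cvg_scale => //; exact: ocS.
Qed.

HB.instance Definition _ :=
  GRing.isSubmodClosed.Build R (X -> Z) Loc_pred Loc_submod_closed.

Record Loc := MkLoc { Loc_fun :> X -> Z; Loc_funP : Loc_fun \in Loc_pred }.

HB.instance Definition _ := [isSub for Loc_fun].
HB.instance Definition _ := [Choice of Loc by <:].
HB.instance Definition _ := [SubChoice_isSubLmodule of Loc by <:].

Definition Loc_le (S T : Loc) : bool := `[< positive_op (T - S) >].

Lemma LocP (S T : Loc) : (forall x, S x = T x) -> S = T.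
Proof. by move=> ST; apply/val_inj/funext. Qed.

Lemma Loc_lin (T : Loc) : linear T.
Proof. by have /asboolP[] := Loc_funP T. Qed.

Lemma Loc_le_refl : reflexive Loc_le.
Proof. by move=> T; apply/asboolP => x x0; rewrite subrr. Qed.

Lemma Loc_le_anti : antisymmetric Loc_le.
Proof.
move=> S T /andP[/asboolP ST /asboolP TS]; apply: LocP => x.
have eqp y : 0 <= y -> S y = T y.
  move=> y0; apply: le_anti; rewrite lev_subr [X in _ && X]lev_subr.
  by rewrite ST // TS.
have lB (U : Loc) u v : U (u - v) = U u - U v.
  by rewrite addrC -scaleN1r Loc_lin scaleN1r addrC.
have [w [xw w0]] := ov_directed x 0.
have wx0 : 0 <= w - x by rewrite -lev_subr.
by rewrite -[x](subKr w) (lB S) (lB T) (eqp _ w0) (eqp _ wx0).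
Qed.

Lemma Loc_le_trans : transitive Loc_le.
Proof.
move=> T S U /asboolP ST /asboolP TU; apply/asboolP => x x0.
by have := addv_ge0 (TU x x0) (ST x x0); rewrite addrA subrK.
Qed.

HB.instance Definition _ := Order.Le_isPOrder.Build ring_display Loc
  Loc_le_refl Loc_le_anti Loc_le_trans.

Lemma Loc_lev_addr (S T U : Loc) : S <= T -> S + U <= T + U.
Proof.
by move=> /asboolP ST; apply/asboolP; rewrite opprD addrACA subrr addr0.
Qed.

Lemma Loc_lev_scale (a : R) (S T : Loc) : 0 <= a -> S <= T -> a *: S <= a *: T.
Proof.
move=> a0 /asboolP ST; apply/asboolP => x x0; rewrite -scalerBr.
by apply: scalev_ge0 => //; exact: ST.
Qed.

HB.instance Definition _ :=
  Lmodule_isOrdered.Build R Loc Loc_lev_addr Loc_lev_scale.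

End Loc.

(* The order on sequences is the library's pointwise order on functions. *)
Section Sequences.
Context (R : realType).

Definition bounded_seq_pred : {pred nat -> R} :=
  fun x => `[< exists M : R, forall i, `|x i| <= M >].

Lemma bounded_seq_submod_closed : submod_closed bounded_seq_pred.
Proof.
split=> [|a x y /asboolP[M xM] /asboolP[N yN]]; apply/asboolP.
  by exists 0 => i; rewrite normr0.
exists (`|a| * M + N) => i; apply: le_trans (ler_normD _ _) _.
by rewrite lerD // normrM ler_wpM2l.
Qed.

HB.instance Definition _ := GRing.isSubmodClosed.Build R (nat -> R)
  bounded_seq_pred bounded_seq_submod_closed.

Record linf := MkLinf {
  linf_seq :> nat -> R; linf_seqP : linf_seq \in bounded_seq_pred }.

HB.instance Definition _ := [isSub for linf_seq].
HB.instance Definition _ := [Choice of linf by <:].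
HB.instance Definition _ := [SubChoice_isSubLmodule of linf by <:].
HB.instance Definition _ := [SubChoice_isSubPOrder of linf by <: with ring_display].

Lemma linf_leP (x y : linf) : reflect (forall i, x i <= y i) (x <= y).
Proof. exact: lefP. Qed.

Lemma linf_lev_addr (x y z : linf) : x <= y -> x + z <= y + z.
Proof. by move=> /linf_leP xy; apply/linf_leP => i; rewrite lerD2r. Qed.

Lemma linf_lev_scale (a : R) (x y : linf) : 0 <= a -> x <= y -> a *: x <= a *: y.
Proof.
by move=> a0 /linf_leP xy; apply/linf_leP => i; exact: (ler_wpM2l a0 (xy i)).
Qed.

HB.instance Definition _ :=
  Lmodule_isOrdered.Build R linf linf_lev_addr linf_lev_scale.

Definition evconst_seq_pred : {pred nat -> R} :=
  fun x => `[< exists (c : R) (k : nat), forall i, (k <= i)%N -> x i = c >].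

Lemma evconst_seq_submod_closed : submod_closed evconst_seq_pred.
Proof.
split=> [|a x y /asboolP[b [k xb]] /asboolP[c [l yc]]]; apply/asboolP.
  by exists 0, 0%N.
exists (a * b + c), (maxn k l) => i; rewrite geq_max => /andP[ki li].
by rewrite !fctE /= xb // yc.
Qed.

HB.instance Definition _ := GRing.isSubmodClosed.Build R (nat -> R)
  evconst_seq_pred evconst_seq_submod_closed.

Record l0inf := MkL0inf {
  l0inf_seq :> nat -> R; l0inf_seqP : l0inf_seq \in evconst_seq_pred }.

HB.instance Definition _ := [isSub for l0inf_seq].
HB.instance Definition _ := [Choice of l0inf by <:].
HB.instance Definition _ := [SubChoice_isSubLmodule of l0inf by <:].
HB.instance Definition _ := [SubChoice_isSubPOrder of l0inf by <: with ring_display].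

Lemma l0inf_leP (x y : l0inf) : reflect (forall i, x i <= y i) (x <= y).
Proof. exact: lefP. Qed.

Lemma l0inf_lev_addr (x y z : l0inf) : x <= y -> x + z <= y + z.
Proof. by move=> /l0inf_leP xy; apply/l0inf_leP => i; rewrite lerD2r. Qed.

Lemma l0inf_lev_scale (a : R) (x y : l0inf) :
  0 <= a -> x <= y -> a *: x <= a *: y.
Proof.
by move=> a0 /l0inf_leP xy; apply/l0inf_leP => i; exact: (ler_wpM2l a0 (xy i)).
Qed.

HB.instance Definition _ :=
  Lmodule_isOrdered.Build R l0inf l0inf_lev_addr l0inf_lev_scale.

Lemma evconst_bounded (x : l0inf) : (x : nat -> R) \in bounded_seq_pred.
Proof.
have /asboolP[c [k xc]] := l0inf_seqP x; apply/asboolP.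
exists (`|c| + \sum_(j < k) `|x j|) => i; have [ki|ik] := leqP k i.
  by rewrite xc // lerDl sumr_ge0.
rewrite (bigD1 (Ordinal ik)) //= addrCA lerDl addr_ge0 // sumr_ge0 //.
Qed.

Definition l0inf_incl (x : l0inf) : linf := MkLinf (evconst_bounded x).

Lemma l0inf_directed (x y : l0inf) : exists z : l0inf, x <= z /\ y <= z.
Proof.
have /asboolP[M xM] := evconst_bounded x.
have /asboolP[N yN] := evconst_bounded y.
have zP : (fun=> Num.max M N) \in evconst_seq_pred.
  by apply/asboolP; exists (Num.max M N), 0%N.
exists (MkL0inf zP); split; apply/l0inf_leP => i /=; rewrite le_max.
  by rewrite (le_trans (ler_norm _) (xM i)).
by rewrite (le_trans (ler_norm _) (yN i)) orbT.
Qed.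

HB.instance Definition _ := OrdVect_isDirected.Build R l0inf l0inf_directed.

Lemma decr_to0_incl d (I : preorderType d) (z : I -> l0inf) :
  decr_to0 z -> decr_to0 (l0inf_incl \o z).
Proof.
move=> [zd [z0 zinf]]; split=> [i j /zd /l0inf_leP zij|]; first exact/linf_leP.
split=> [_ [i _ <-]|u ulb].
  have /l0inf_leP zi0 : 0 <= z i by apply: z0; exists i.
  exact/linf_leP.
apply/linf_leP => n.
have eP : (fun m => if m == n then u n else 0) \in evconst_seq_pred.
  by apply/asboolP; exists 0, n.+1 => i; case: eqP => // ->; rewrite ltnn.
suff /l0inf_leP/(_ n) : MkL0inf eP <= 0 by rewrite /= eqxx.
apply: zinf => _ [i _ <-]; apply/l0inf_leP => m /=; case: eqP => [->|_].
  have /linf_leP : u <= l0inf_incl (z i) by apply: ulb; exists i.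
  by apply.
have /l0inf_leP zi0 : 0 <= z i by apply: z0; exists i.
exact: zi0.
Qed.

Lemma incl_comp_Loc (T : Loc l0inf l0inf) :
  (l0inf_incl \o T) \in @Loc_pred R l0inf linf.
Proof.
have /asboolP[linT ocT] := Loc_funP T; apply/asboolP; split.
  by move=> a x y; apply: val_inj; rewrite /= linT.
move=> d I x_ x dirI /(ocT _ _ _ _ dirI)[z [zd zP]].
exists (l0inf_incl \o z); split=> [|i]; first exact: decr_to0_incl.
have [/l0inf_leP z1 /l0inf_leP z2] := zP i.
by split; apply/linf_leP.
Qed.

Definition incl_comp (T : Loc l0inf l0inf) : Loc l0inf linf :=
  MkLoc (incl_comp_Loc T).

(* L_oc(l0inf, l0inf)_+ - L_oc(l0inf, l0inf)_+, embedded in L_oc(l0inf, linf)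
   by composition with the inclusion; positivity of the two terms refers to
   operators into l0inf. *)
Definition Loc_diamond : set (Loc l0inf linf) :=
  incl_comp @` directed_part.

Lemma Loc_diamond_submod :
  Loc_diamond 0 /\
  forall (a : R) (S T : Loc l0inf linf),
    Loc_diamond S -> Loc_diamond T -> Loc_diamond (a *: S + T).
Proof.
have [d0 dD] := directed_part_submod (Loc l0inf l0inf).
split=> [|a _ _ [S dS <-] [T dT <-]].
  by exists 0 => //; apply: LocP => x; exact: val_inj.
exists (a *: S + T); first exact: dD.
by apply: LocP => x; exact: val_inj.
Qed.

End Sequences.
Arguments Loc_diamond : clear implicits.

(* Main.v *)
Require Import Defs.
From mathcomp Require Import all_boot all_order all_algebra.
From mathcomp Require Import all_classical reals.

(** Let [sigma : nat -> nat] have infinite fibres. The order continuous operator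
    [x |-> x \o sigma] sends each unit vector [e_n] to a sequence which is [1]
    infinitely often. If a positive [A] into the eventually constant sequences
    dominates it, then every [A e_n] is eventually at least [1]; as
    [e_0 + ... + e_(n-1) <= 1], the sequence [A 1] is unbounded, a
    contradiction. *)

Set Implicit Arguments.
Unset Strict Implicit.
Unset Printing Implicit Defensive.

Import Order.TTheory GRing.Theory Num.Theory.
Local Open Scope classical_set_scope.
Local Open Scope ring_scope.

(** If no element of [D] lies above [x], the set whose infimum is [x] is empty, so every vector is a
    lower bound of it. The lower bound [x + x] then gives [x <= 0], and [0] itself is a majorant in
    [D]. *)
Lemma order_dense_majorizing (R : numDomainType) (V : ordVectType R)
  (D : set V) : D 0 -> order_dense D -> majorizing D.
Proof.
move=> D0 dD x; have [_ xinf] := dD x; apply: contrapT => nmaj.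
have /xinf : lbound [set z | D z /\ x <= z] (x + x).
  by move=> z [Dz xz]; case: nmaj; exists z.
rewrite lev_subr opprD addrA subrr add0r => x0; apply: nmaj; exists 0 => //.
by rewrite lev_subr add0r.
Qed.

Section Reindexing.
Context (R : realType) (sigma : nat -> nat).

Lemma reindex_bounded (x : l0inf R) :
  (fun i => x (sigma i)) \in @bounded_seq_pred R.
Proof.
have /asboolP[M xM] := evconst_bounded x.
by apply/asboolP; exists M => i; exact: xM.
Qed.

(** The codomain is [linf] because [x \o sigma] need not be eventually constant. *)
Definition reindex_linf (x : l0inf R) : linf R := MkLinf (reindex_bounded x).

(* Infima of positive families in [l0inf] are pointwise: test against multiples
   of unit vectors. *)
Lemma decr_to0_reindex d (I : preorderType d) (z : I -> l0inf R) :
  decr_to0 z -> decr_to0 (reindex_linf \o z).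
Proof.
move=> [zd [z0 zinf]]; have zge0 i m : 0 <= z i m.
  have /l0inf_leP zi0 : 0 <= z i by apply: z0; exists i.
  exact: zi0.
split=> [i j /zd /l0inf_leP zij|]; first by apply/linf_leP => n; exact: zij.
split=> [_ [i _ <-]|u ulb].
  by apply/linf_leP => n; exact: zge0.
apply/linf_leP => n.
have eP : (fun m => if m == sigma n then u n else 0) \in @evconst_seq_pred R.
  by apply/asboolP; exists 0, (sigma n).+1 => i; case: eqP => // ->; rewrite ltnn.
suff /l0inf_leP/(_ (sigma n)) : MkL0inf eP <= 0 by rewrite /= eqxx.
apply: zinf => _ [i _ <-]; apply/l0inf_leP => m /=; case: eqP => [->|_].
  have /linf_leP : u <= reindex_linf (z i) by apply: ulb; exists i.
  by apply.
exact: zge0.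
Qed.

Lemma reindex_Loc : reindex_linf \in @Loc_pred R (l0inf R) (linf R).
Proof.
apply/asboolP; split=> [a x y|d I x_ x _ [z [zd zP]]].
  exact: val_inj.
exists (reindex_linf \o z); split=> [|i]; first exact: decr_to0_reindex.
have [/l0inf_leP z1 /l0inf_leP z2] := zP i.
by split; apply/linf_leP => n; [exact: z1 | exact: z2].
Qed.

Definition reindex_op : Loc (l0inf R) (linf R) := MkLoc reindex_Loc.

End Reindexing.

Section Indicators.
Context (R : realType).

Lemma unit_seq_evconst (n : nat) :
  (fun m => (m == n)%:R) \in @evconst_seq_pred R.
Proof.
by apply/asboolP; exists 0, n.+1 => i; case: eqP => // ->; rewrite ltnn.
Qed.

Definition unit_seq n : l0inf R := MkL0inf (unit_seq_evconst n).

Lemma initial_seq_evconst (n : nat) :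
  (fun m => (m < n)%N%:R) \in @evconst_seq_pred R.
Proof. by apply/asboolP; exists 0, n => i; rewrite leqNgt; case: ltnP. Qed.

Definition initial_seq n : l0inf R := MkL0inf (initial_seq_evconst n).

Lemma one_seq_evconst : (fun=> 1) \in @evconst_seq_pred R.
Proof. by apply/asboolP; exists 1, 0%N. Qed.

Definition one_seq : l0inf R := MkL0inf one_seq_evconst.

(** The factor [1] gives the sum the shape [a *: x + y] to which [Loc_lin] applies. *)
Lemma initial_seqS n : initial_seq n.+1 = 1 *: unit_seq n + initial_seq n.
Proof.
apply/val_inj/funext => m; rewrite scale1r /= !fctE /= ltnS leq_eqVlt.
by case: eqP => [->|_] /=; rewrite ?ltnn ?addr0 ?add0r.
Qed.

Lemma unit_seq_ge0 n : 0 <= unit_seq n.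
Proof. by apply/l0inf_leP => m /=; exact: ler0n. Qed.

Lemma initial_seq_le1 n : 0 <= one_seq - initial_seq n.
Proof. by apply/l0inf_leP => m; rewrite /= !fctE subr_ge0 lern1 leq_b1. Qed.

End Indicators.

Lemma reindex_op_not_dominated (R : realType) (sigma : nat -> nat)
    (A : Loc (l0inf R) (l0inf R)) :
  (forall n k, exists2 i, (k <= i)%N & sigma i = n) ->
  positive_op A ->
  ~ forall x : l0inf R, 0 <= x -> reindex_op R sigma x <= l0inf_incl (A x).
Proof.
move=> sigmaP A0 domA.
have A_unit n : exists k, forall i, (k <= i)%N -> 1 <= A (unit_seq R n) i.
  have /asboolP[c [k Ac]] := l0inf_seqP (A (unit_seq R n)).
  (* From [k] on the sequence is constant, so its value at [i] can be read off at a later point [j]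
     of the fibre over [n], where the reindexed unit vector is [1]. *)
  exists k => i ki; have [j kj sj] := sigmaP n k; rewrite Ac // -(Ac j) //.
  have /linf_leP/(_ j) := domA _ (unit_seq_ge0 R n).
  by rewrite /= sj eqxx.
(* The threshold [k] may depend on [n]: a single coordinate above the bound of [A 1] is enough for
   the contradiction. *)
have A_initial n : exists k, forall i, (k <= i)%N ->
    n%:R <= A (initial_seq R n) i.
  elim: n => [|n [k kP]].
    exists 0%N => i _; have /A0/l0inf_leP : 0 <= initial_seq R 0.
      by apply/l0inf_leP => m /=; exact: ler0n.
    by apply.
  have [l lP] := A_unit n; exists (maxn k l) => i.
  rewrite geq_max => /andP[/kP ki /lP li].
  by rewrite initial_seqS Loc_lin scale1r /= !fctE -natr1 addrC lerD.
have /asboolP[M AM] := evconst_bounded (A (one_seq R)).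
(* [Num.bound M] is a natural number strictly above [M], since [M] bounds absolute values and so is
   nonnegative. *)
have [k kP] := A_initial (Num.bound M).
have : A (initial_seq R (Num.bound M)) k <= M.
  apply: le_trans (le_trans (ler_norm _) (AM k)).
  have /A0/l0inf_leP/(_ k) := initial_seq_le1 R (Num.bound M).
  rewrite [_ - _]addrC -scaleN1r Loc_lin scaleN1r /= !fctE.
  by rewrite addrC subr_ge0.
apply/negP; rewrite -ltNge; apply: lt_le_trans (kP k (leqnn k)).
apply: archi_boundP; exact: le_trans (normr_ge0 _) (AM k).
Qed.

(** The 2-adic valuation serves as [sigma]: multiplying [2 ^ n] by the odd number [2k + 1] keeps the
    valuation [n] and exceeds [k]. *)
Lemma logn2_infinite_fibres n k : exists2 i, (k <= i)%N & logn 2 i = n.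
Proof.
exists (2 ^ n * k.*2.+1)%N.
  rewrite (@leq_trans k.*2.+1) ?leq_pmull ?expn_gt0 //.
  by rewrite -addnn -addnS leq_addr.
rewrite lognM ?expn_gt0 // pfactorK // lognE /= dvdn2 /= odd_double /=.
by rewrite addn0.
Qed.

Theorem mainTheorem5 (R : realType) :
  ~ majorizing (Loc_diamond R) /\ ~ order_dense (Loc_diamond R).
Proof.
have nmaj : ~ majorizing (Loc_diamond R).
  move=> /(_ (reindex_op R (logn 2)))[_ [_ [A [B [A0 B0 ->]] <-]] /asboolP TAB].
  have pos (C : Loc (l0inf R) (l0inf R)) : 0 <= C -> positive_op C.
    by move=> /asboolP C0 x /C0; rewrite subr0.
  (* On positive [x] one has [A x - B x <= A x], so a majorant [A - B] makes the positive operator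
     [A] dominate as well. *)
  apply: (reindex_op_not_dominated logn2_infinite_fibres (pos _ A0)) => x x0.
  apply/linf_leP => i; have /linf_leP/(_ i) := TAB x x0.
  have /l0inf_leP/(_ i) := pos _ B0 x x0.
  rewrite /= !fctE /= => Bx; rewrite subr_ge0 => /le_trans; apply.
  by rewrite gerBl.
split=> // dD; apply/nmaj/order_dense_majorizing => //.
by have [] := Loc_diamond_submod R.
Qed.
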